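(* Let $(\alpha^{(j)})_{j\ge1}$ be a sequence of integer sequences, where $\alpha^{(j)}$ has length $n_j$, entries $\alpha^{(j)}_1\ge\dots\ge\alpha^{(j)}_{n_j}\ge0$, and even sum $s_j\le n_j(n_j-1)$. Suppose $n_j\to\infty$ and $s_j=o(n_j^2)$ (i.e. $s_j/n_j^2\to0$). Then $$\lim_{j\to\infty} TV\big(P(\alpha^{(j)}),\,P(\alpha^{(j)}\wedge T(n_j,s_j))\big)=0.$$
   Context: Notation: $\langle a^r\rangle$ denotes $r$ consecutive copies of $a$. For integers $n\ge1$ and even $s$ with $0\le s\le n(n-1)$, let $m=\min\{k\ge 1 : s\le k(k-1)\}$ and define the length-$n$ sequence $T(n,s)$ recursively: (i) if $s=0$, $T(n,s)=\langle 0^n\rangle$; (ii) if $s>0$ and $n>m$, $T(n,s)=\langle \gamma_1,\dots,\gamma_m,0^{n-m}\rangle$ with $\gamma=T(m,s)$; (iii) if $s>0$ and $n\le m$, $T(n,s)=\langle n-1,\gamma_1+1,\dots,\gamma_{n-1}+1\rangle$ with $\gamma=T(n-1,s-2(n-1))$. For length-$n$ sequences $\alpha,\beta$ with equal sums, the meet $\alpha\wedge\beta$ is the length-$n$ sequence with $(\alpha\wedge\beta)_k=\min\{\sum_{i=1}^k\alpha_i,\sum_{i=1}^k\beta_i\}-\min\{\sum_{i=1}^{k-1}\alpha_i,\sum_{i=1}^{k-1}\beta_i\}$ (empty sums are $0$). For a length-$n$ sequence $\alpha$ of integers in $\{0,\dots,n-1\}$, let $r_i$ be the number of entries of $\alpha$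 equal to $i$, and define $P(\alpha)=\langle r_1/n,\dots,r_{n-1}/n\rangle$, i.e. $P(\alpha)_i=r_i/n$ for $i=1,\dots,n-1$. For two such vectors $P,Q$ indexed by $\omega\in\Omega=\{1,\dots,n-1\}$, the (paper's) total variation distance is $TV(P,Q)=\sup_{\omega\in\Omega}|P_\omega-Q_\omega|$. *)

(* Defs.v *)
From HB Require Import structures.
From mathcomp Require Import all_boot all_order all_algebra.
Set Implicit Arguments. Unset Strict Implicit. Unset Printing Implicit Defensive.
Import Order.TTheory GRing.Theory Num.Theory.

(* m(s) = min { k >= 1 : s <= k(k-1) }; k = s+1 always works, so searching
   k-1 in [0, s] suffices. *)
Definition mT (s : nat) : nat :=
  (find (fun k => s <= k.+1 * k) (iota 0 s.+1)).+1.

(* T(n,s), via fuel (n strictly decreases along the recursion). *)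
Fixpoint Tfuel (fuel n s : nat) : seq nat :=
  match fuel with
  | 0 => nseq n 0
  | fuel'.+1 =>
    if s == 0 then nseq n 0
    else let m := mT s in
      if m < n then Tfuel fuel' m s ++ nseq (n - m) 0
      else match n with
           | 0 => [::]
           | n'.+1 => n' :: map succn (Tfuel fuel' n' (s - 2 * n'))
           end
  end.

Definition T (n s : nat) : seq nat := Tfuel n.+1 n s.

Definition psum (a : seq nat) (k : nat) : nat := sumn (take k a).

Definition meet (a b : seq nat) : seq nat :=
  mkseq (fun k => minn (psum a k.+1) (psum b k.+1) - minn (psum a k) (psum b k))
        (size a).

Definition Pdist (a : seq nat) (i : nat) : rat :=
  (count_mem i a)%:R / (size a)%:R.

Local Open Scope ring_scope.
Definition TV (n : nat) (P Q : nat -> rat) : rat :=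
  \big[Num.max/0]_(1 <= i < n) `|P i - Q i|.
Local Close Scope ring_scope.
Example T_ex : T 4 6 = [:: 2; 2; 2; 0]. Proof. by []. Qed.
Example T_ex2 : T 4 12 = [:: 3; 3; 3; 3]. Proof. by []. Qed.
Example T_ex3 : T 5 8 = [:: 3;2;2;1;0]. Proof. by []. Qed.

(* Main.v *)
(** The partial sums of [T n s] reach the total [s] by position [m = mT s],
    whereas the partial sums of a sequence of sum [s] never exceed [s]. Hence
    the meet agrees with [a] from position [m] on, each value count changes by at
    most [m], and the distance is at most [m / n]. By minimality of [m],
    [(m - 2)^2 <= s], so that [m / n <= sqrt (s / n^2) + 2 / n]. *)
Require Import Defs.
From HB Require Import structures.
From mathcomp Require Import all_boot all_order all_algebra.
From mathcomp Require Import zify lra.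
Import Order.TTheory GRing.Theory Num.Theory.
Local Open Scope ring_scope.

Lemma leq_mT s : (s <= mT s * (mT s).-1)%N.
Proof.
have hs : has (fun k => s <= k.+1 * k)%N (iota 0 s.+1).
  by apply/hasP; exists s; rewrite ?mem_iota //; nia.
have := nth_find 0%N hs; rewrite nth_iota ?add0n //.
by rewrite -[X in (_ < X)%N](size_iota 0) -has_find.
Qed.

Lemma ltn_mT s k : (k.+1 < mT s)%N -> (k.+1 * k < s)%N.
Proof.
rewrite ltnS => lt_k; have := before_find 0%N lt_k.
rewrite nth_iota ?add0n; first by rewrite ltnNge => ->.
by rewrite (leq_trans lt_k) // -[X in (_ <= X)%N](size_iota 0) find_size.
Qed.

(** Minimality at [mT s - 1] gives [(m - 1)(m - 2) < s] when [m = mT s >= 2]; smaller [m] is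
    absorbed by truncated subtraction. *)
Lemma mT_sqr_le s : ((mT s - 2) ^ 2 <= s)%N.
Proof.
case def_m: (mT s) => [|[|k]] //.
by have := @ltn_mT s k; rewrite def_m; nia.
Qed.

Lemma size_Tfuel fuel n s : size (Tfuel fuel n s) = n.
Proof.
elim: fuel n s => [|fuel IHf] n s /=; first by rewrite size_nseq.
case: ifP => _; first by rewrite size_nseq.
case: ltnP => [lt_m|_]; first by rewrite size_cat IHf size_nseq; lia.
by case: n => //= n; rewrite size_map IHf.
Qed.

(** Both recursive calls shorten the sequence, so the fuel suffices, and they preserve parity and
    the bound on [s]. Rule (iii) adds up to [n + (s - 2n) + n]. *)
Lemma sumn_Tfuel fuel n s :
  (n < fuel)%N -> ~~ odd s -> (s <= n * n.-1)%N -> sumn (Tfuel fuel n s) = s.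
Proof.
elim: fuel n s => // fuel IHf n s lt_n ev_s le_s /=.
case: eqP => [->|s_n0]; first by rewrite sumn_nseq.
case: ltnP => [lt_m|].
  by rewrite sumn_cat sumn_nseq addn0 IHf ?leq_mT //; lia.
case: n => [|n] in lt_n le_s *; first by lia.
move=> le_n.
have lt_s: (0 < n)%N -> (n * n.-1 < s)%N.
  by case: n le_n {lt_n le_s} => // k /ltn_mT.
(* This makes the truncated [s - 2 * n] exact. Parity settles [n = 1] and [n = 2]; beyond that
   [n * n.-1] is already at least [2 * n]. *)
have le_2n: (2 * n <= s)%N.
  by case: n lt_s {lt_n le_s le_n} => [|[|[|n]]] /= lt_s; nia.
have sumn_S t : sumn (map succn t) = (sumn t + size t)%N.
  by elim: t => //= x t ->; lia.
by rewrite /= sumn_S size_Tfuel IHf; nia.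
Qed.

Lemma psum_T n s k :
  ~~ odd s -> (s <= n * n.-1)%N -> (mT s <= k)%N -> psum (T n s) k = s.
Proof.
move=> ev_s le_s le_k; rewrite /psum.
have [le_n|lt_k] := leqP n k.
  by rewrite take_oversize ?size_Tfuel // sumn_Tfuel.
rewrite /T /=; case: eqP => [->|_].
  by rewrite take_nseq ?sumn_nseq // ltnW.
(* Here [mT s <= k < n]: the prefix contains the whole block of length [mT s], of sum [s], followed
   only by padding zeros. *)
rewrite (leq_ltn_trans le_k lt_k) take_cat size_Tfuel ltnNge le_k /=.
rewrite take_nseq ?leq_sub2r ?(ltnW lt_k) //.
by rewrite sumn_cat sumn_nseq addn0 sumn_Tfuel ?leq_mT // (leq_ltn_trans le_k).
Qed.

Lemma psum_le_sumn a k : (psum a k <= sumn a)%N.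
Proof. by rewrite -[in X in (_ <= X)%N](cat_take_drop k a) sumn_cat leq_addr. Qed.

Lemma psumS a k : (k < size a)%N -> psum a k.+1 = (psum a k + nth 0 a k)%N.
Proof. by move=> lt_k; rewrite /psum (take_nth 0%N) // sumn_rcons. Qed.

Lemma size_meet a b : size (meet a b) = size a.
Proof. exact: size_mkseq. Qed.

(** From [m] on, both minima defining an entry of the meet are partial sums of [a], whose difference
    is the entry of [a]. *)
Lemma drop_meet m a b :
    (forall k, (m <= k)%N -> (psum a k <= psum b k)%N) ->
  drop m (meet a b) = drop m a.
Proof.
move=> le_ab; apply: (@eq_from_nth _ 0%N); rewrite !size_drop size_meet // => k.
rewrite ltn_subRL => lt_k.
rewrite !nth_drop nth_mkseq // !(minn_idPl _) ?le_ab ?leqW ?leq_addr //.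
by rewrite psumS // addKn.
Qed.

(** The common tails cancel, and each head contributes a count between 0 and [m]. *)
Lemma Pdist_dist_le m a b i :
    size a = size b -> drop m a = drop m b ->
  `|Pdist a i - Pdist b i| <= m%:R / (size a)%:R.
Proof.
move=> eq_sz eq_drop; rewrite /Pdist -eq_sz -mulrBl normrM normfV normr_nat.
rewrite ler_wpM2r ?invr_ge0 ?ler0n //.
have countE c : count_mem i c = (count_mem i (take m c) + count_mem i (drop m c))%N.
  by rewrite -count_cat cat_take_drop.
have count_m c : (count_mem i (take m c) <= m)%N.
  by rewrite (leq_trans (count_size _ _)) // size_take_min geq_minl.
rewrite (countE a) (countE b) eq_drop !natrD ler_norml.
have := count_m a; have := count_m b; rewrite -!(ler_nat rat).
have := ler0n rat (count_mem i (take m a)).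
have := ler0n rat (count_mem i (take m b)).
by lra.
Qed.

Lemma TV_le n P Q c :
  0 <= c -> (forall i, `|P i - Q i| <= c) -> `|TV n P Q| <= c.
Proof.
move=> c_ge0 le_c; rewrite /TV; elim/big_ind: _ => [|x y|i _].
- by rewrite normr0.
- by rewrite /Num.max; case: ifP.
- by rewrite normr_id.
Qed.

Lemma mT_ratio_le s n (eps : rat) :
    0 < eps -> 4 / eps <= n%:R -> s%:R / (n ^ 2)%:R <= (eps / 2) ^+ 2 ->
  (mT s)%:R / n%:R <= eps.
Proof.
move=> eps_gt0 le_n le_s.
have n_gt0 : 0 < n%:R :> rat by apply: lt_le_trans le_n; rewrite divr_gt0.
move: le_n le_s; rewrite natrX !ler_pdivrMr ?exprn_gt0 // => le_n.
rewrite -exprMn => le_s.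
(* Comparing squares avoids square roots. The other half of [eps] absorbs the remaining 2, since
   [4 / eps <= n]. *)
have le_m : (mT s - 2)%:R <= eps / 2 * n%:R.
  have c_ge0 : 0 <= eps / 2 * n%:R by rewrite mulr_ge0 ?divr_ge0 ?ltW.
  rewrite -ler_sqr ?nnegrE //.
  by apply: le_trans le_s; rewrite -natrX ler_nat mT_sqr_le.
have : (mT s)%:R <= 2 + (mT s - 2)%:R :> rat.
  by rewrite -natrD ler_nat; lia.
by lra.
Qed.

Theorem theorem5 (a : nat -> seq nat) :
  (forall j, sorted geq (a j)) ->
  (forall j, all (fun x => x < size (a j))%N (a j)) ->
  (forall j, ~~ odd (sumn (a j))) ->
  (forall j, (sumn (a j) <= size (a j) * (size (a j)).-1)%N) ->
  (forall N : nat, exists J : nat, forall j, (J <= j)%N -> (N <= size (a j))%N) ->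
  (forall eps : rat, 0 < eps -> exists J : nat, forall j, (J <= j)%N ->
     `|(sumn (a j))%:R / ((size (a j)) ^ 2)%:R| <= eps) ->
  forall eps : rat, 0 < eps -> exists J : nat, forall j, (J <= j)%N ->
    `|TV (size (a j)) (Pdist (a j))
        (Pdist (meet (a j) (T (size (a j)) (sumn (a j)))))| <= eps.
Proof.
move=> _ _ ev_s le_s size_oo s_small eps eps_gt0.
have [J1 size_ge] := size_oo (Num.bound (4 / eps)).
have e2_gt0 : 0 < (eps / 2) ^+ 2 by rewrite exprn_gt0 ?divr_gt0.
have [J2 s_le] := s_small _ e2_gt0.
exists (maxn J1 J2) => j; rewrite geq_max => /andP[/size_ge le_n /s_le].
move=> /(le_trans (ler_norm _)) le_e2; apply: TV_le (ltW eps_gt0) _ => i.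
apply: le_trans (Pdist_dist_le (mT (sumn (a j))) _ _ i _ _) _.
- by rewrite size_meet.
(* From [mT s] on, the partial sums of [T] equal the full sum of [a j]. *)
- by rewrite drop_meet // => k le_k; rewrite psum_T ?psum_le_sumn.
apply: mT_ratio_le le_e2 => //.
have : 4 / eps < (Num.bound (4 / eps))%:R.
  by rewrite archi_boundP // divr_ge0 ?ltW.
by move=> /ltW/le_trans; apply; rewrite ler_nat.
Qed.
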